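(* Let $\mathbb{K}=\mathbb{R}$ or $\mathbb{K}=\mathbb{C}$ and let $A\in\mathbb{K}^{m\times k}$, $B\in\mathbb{K}^{k\times n}$. Then $$(AB)^+=B^+A^+\iff B^+A^+(AB)(AB)^*(AB)B^+A^+=(AB)^*.$$ Moreover, in such a case, writing $W=AB$, $r=\operatorname{rank}W$, and letting $W=U\Sigma V^*$ be an SVD of $W$ over $\mathbb{K}$, the matrix $X=B^+A^+$ is given by the formula $$X=V\Sigma^{+}DU^*+P_{\mathcal{N}(W)}\,Y\,P_{\mathcal{N}(W^* )}$$ with $D=\operatorname{diag}(I_r,0)\in\mathbb{K}^{m\times m}$ and $Y=0\in\mathbb{K}^{n\times m}$.
   Context: $A^*$ denotes the conjugate transpose (transpose over $\mathbb{R}$) and $A^+$ the Moore--Penrose pseudoinverse of $A$. $\mathcal{N}(A)$ denotes the null space of $A$, and $P_{\mathcal{S}}$ the orthogonal projection matrix onto a subspace $\mathcal{S}$. An SVD of $W\in\mathbb{K}^{m\times n}$ over $\mathbb{K}$ is a factorization $W=U\Sigma V^*$ with $U\in\mathbb{K}^{m\times m}$, $V\in\mathbb{K}^{n\times n}$ unitary (orthogonal if $\mathbb{K}=\mathbb{R}$) and $\Sigma\in\mathbb{R}^{m\times n}$ generalized diagonal with non-negative diagonal entries in decreasing (non-increasing) order. *)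

(* Defs.v *)
From HB Require Import structures.
From mathcomp Require Import all_boot all_order all_algebra.
From mathcomp Require Import complex reals.

Set Implicit Arguments.
Unset Strict Implicit.
Unset Printing Implicit Defensive.

Import Order.TTheory GRing.Theory Num.Theory.
Local Open Scope ring_scope.

(* The coefficient field is R or R[i]; the tag lets one statement cover both. *)
Inductive base_field := RealNumbers | ComplexNumbers.

Definition scalar_field (R : realType) (b : base_field) : numFieldType :=
  match b with
  | RealNumbers => R
  | ComplexNumbers => R[i]
  end.

Definition of_real (R : realType) (b : base_field) : R -> scalar_field R b :=
  match b with
  | RealNumbers => fun x => x
  | ComplexNumbers => fun x => x%:C%C
  end.

Definition conjs (R : realType) (b : base_field) : scalar_field R b -> scalar_field R b :=
  match b with
  | RealNumbers => fun x => x
  | ComplexNumbers => fun x => conjc x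
  end.

Section Conj.
Context {R : realType} {b : base_field}.
Implicit Types x y : scalar_field R b.

Fact conj_is_additive : zmod_morphism (@conjs R b).
Proof. by case: b => //= x y; rewrite rmorphB. Qed.

Fact conj_is_multiplicative : monoid_morphism (@conjs R b).
Proof.
by case: b; split=> //= [|x y]; [exact: conjc1 | rewrite rmorphM].
Qed.

HB.instance Definition _ :=
  GRing.isZmodMorphism.Build (scalar_field R b) (scalar_field R b) (@conjs R b)
    conj_is_additive.
HB.instance Definition _ :=
  GRing.isMonoidMorphism.Build (scalar_field R b) (scalar_field R b) (@conjs R b)
    conj_is_multiplicative.

Lemma conjsK : involutive (@conjs R b).
Proof. by case: b => //=; exact: conjcK. Qed.

Lemma mul_conj_ge0 x : 0 <= conjs x * x.
Proof.
case: b x => /= x; first by rewrite -expr2 sqr_ge0.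
by rewrite mulrC; exact: (@mul_conjC_ge0 R[i]).
Qed.

Lemma mul_conj_eq0 x : (conjs x * x == 0) = (x == 0).
Proof. by rewrite mulf_eq0 fmorph_eq0 orbb. Qed.

End Conj.

Section Matrices.
Context {R : realType} {b : base_field}.
Local Notation K := (scalar_field R b).

Definition adjmx m n (A : 'M[K]_(m, n)) : 'M[K]_(n, m) :=
  (map_mx (@conjs R b) A)^T.

(* The four Penrose equations. *)
Definition is_mpinv m n (A : 'M[K]_(m, n)) (X : 'M[K]_(n, m)) : bool :=
  [&& A *m X *m A == A,
      X *m A *m X == X,
      adjmx (A *m X) == A *m X
    & adjmx (X *m A) == X *m A].

Definition unitary n (U : 'M[K]_n) : bool :=
  (adjmx U *m U == 1%:M) && (U *m adjmx U == 1%:M).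

(* S is real also over the complex numbers, and is embedded entrywise. *)
Definition is_svd m n (W : 'M[K]_(m, n))
    (U : 'M[K]_m) (S : 'M[R]_(m, n)) (V : 'M[K]_n) : Prop :=
  [/\ unitary U /\ unitary V,
      forall i j, val i != val j -> S i j = 0,
      forall i j, val i = val j -> 0 <= S i j,
      forall i j i' j', val i = val j -> val i' = val j' ->
        (val i <= val i')%N -> S i' j' <= S i j
    & W = U *m map_mx (@of_real R b) S *m adjmx V].

(* Matrices act on column vectors, so these are subspaces of 'cV, unlike the
   row spaces of kermx and of the %MS scope. *)
Definition nullspace m n (A : 'M[K]_(m, n)) : {vspace 'cV[K]_n} :=
  lker (linfun (mulmx A : 'cV[K]_n -> 'cV[K]_m)).

Definition colspace m n (A : 'M[K]_(m, n)) : {vspace 'cV[K]_m} :=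
  limg (linfun (mulmx A : 'cV[K]_n -> 'cV[K]_m)).

Definition is_orthoproj n (S : {vspace 'cV[K]_n}) (P : 'M[K]_n) : bool :=
  [&& P *m P == P, adjmx P == P & colspace P == S].

Lemma adjmxM m n p (A : 'M[K]_(m, n)) (B : 'M[K]_(n, p)) :
  adjmx (A *m B) = adjmx B *m adjmx A.
Proof. by rewrite /adjmx map_mxM trmx_mul. Qed.

Lemma adjmxK m n (A : 'M[K]_(m, n)) : adjmx (adjmx A) = A.
Proof. by apply/matrixP=> i j; rewrite !mxE conjsK. Qed.

Lemma adjmx0 m n : adjmx (0 : 'M[K]_(m, n)) = 0.
Proof. by apply/matrixP=> i j; rewrite !mxE rmorph0. Qed.

Lemma adjmxV n (A : 'M[K]_n) : adjmx (invmx A) = invmx (adjmx A).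
Proof. by rewrite /adjmx map_invmx trmx_inv. Qed.

Lemma adjmx_mul_eq0 m n (A : 'M[K]_(m, n)) : adjmx A *m A = 0 -> A = 0.
Proof.
move=> A0; apply/matrixP=> i j; rewrite mxE; apply/eqP.
have /eqP := congr1 (fun M : 'M_n => M j j) A0; rewrite !mxE.
under eq_bigr do rewrite !mxE.
rewrite psumr_eq0 => [/allP/(_ i (mem_index_enum _))|k _].
  by rewrite mul_conj_eq0.
exact: mul_conj_ge0.
Qed.

Lemma gram_unitmx m n (A : 'M[K]_(m, n)) :
  row_full A -> adjmx A *m A \in unitmx.
Proof.
move=> fA; rewrite -row_full_unit -cokermx_eq0; apply/eqP.
set C := cokermx _; have C0 : A *m C = 0.
  apply: adjmx_mul_eq0.
  by rewrite adjmxM -mulmxA (mulmxA _ A) mulmx_coker mulmx0.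
by rewrite -[C]mul1mx -(mulVpmx fA) -mulmxA C0 mulmx0.
Qed.

Lemma mpinv_exists m n (A : 'M[K]_(m, n)) : exists X, is_mpinv A X.
Proof.
have [r [C [F [fC fF AE]]]] : exists r, exists C : 'M[K]_(m, r),
    exists F : 'M[K]_(r, n), [/\ row_full C, row_free F & A = C *m F].
  exists (\rank A), (col_base A), (row_base A).
  by rewrite col_base_full row_base_free mulmx_base.
have uC : adjmx C *m C \in unitmx by exact: gram_unitmx.
have uF : F *m adjmx F \in unitmx.
  rewrite -{1}[F]adjmxK gram_unitmx // /row_full /adjmx mxrank_tr.
  by rewrite mxrank_map.
pose G := invmx (adjmx C *m C); pose H := invmx (F *m adjmx F).
have GE : G *m adjmx C *m C = 1%:M by rewrite -mulmxA mulVmx.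
have HE : F *m (adjmx F *m H) = 1%:M by rewrite mulmxA mulmxV.
have aG : adjmx G = G by rewrite /G adjmxV adjmxM adjmxK.
have aH : adjmx H = H by rewrite /H adjmxV adjmxM adjmxK.
pose X := (adjmx F *m H) *m (G *m adjmx C).
have AX : A *m X = C *m (G *m adjmx C).
  by rewrite AE /X -mulmxA (mulmxA F) HE mul1mx.
have XA : X *m A = adjmx F *m H *m F.
  by rewrite AE /X -mulmxA (mulmxA _ C) GE mul1mx.
exists X; apply/and4P; split; apply/eqP.
- by rewrite AX AE mulmxA -(mulmxA C) GE mulmx1.
- by rewrite XA /X mulmxA -(mulmxA _ F) HE mulmx1.
- by rewrite AX !adjmxM adjmxK aG mulmxA.
- by rewrite XA !adjmxM adjmxK aH mulmxA.
Qed.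

Lemma is_mpinv_uniq m n (A : 'M[K]_(m, n)) X Y :
  is_mpinv A X -> is_mpinv A Y -> X = Y.
Proof.
move=> /and4P[/eqP x1 /eqP x2 /eqP x3 /eqP x4].
move=> /and4P[/eqP y1 /eqP y2 /eqP y3 /eqP y4].
have e1 : A *m X = A *m Y.
  have -> : A *m X = adjmx (A *m Y *m (A *m X)) by rewrite mulmxA y1 x3.
  by rewrite adjmxM x3 y3 mulmxA x1.
have e2 : X *m A = Y *m A.
  have -> : X *m A = adjmx (X *m A *m (Y *m A)).
    by rewrite -mulmxA (mulmxA A) y1 x4.
  by rewrite adjmxM x4 y4 -mulmxA (mulmxA A) x1.
by rewrite -x2 -mulmxA e1 mulmxA e2 y2.
Qed.

Definition mpinv m n (A : 'M[K]_(m, n)) : 'M[K]_(n, m) :=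
  xchoose (mpinv_exists A).

Lemma mpinvP m n (A : 'M[K]_(m, n)) : is_mpinv A (mpinv A).
Proof. exact: xchooseP. Qed.

Lemma colspaceP m n (A : 'M[K]_(m, n)) (y : 'cV[K]_m) :
  reflect (exists x, y = A *m x) (y \in colspace A).
Proof.
apply: (iffP memv_imgP) => [[x _ ->]|[x ->]];
  by exists x; rewrite ?memvf ?lfunE.
Qed.

Lemma nullspaceP m n (A : 'M[K]_(m, n)) (x : 'cV[K]_n) :
  (x \in nullspace A) = (A *m x == 0).
Proof. by rewrite memv_ker lfunE. Qed.

Lemma orthoproj_exists n (S : {vspace 'cV[K]_n}) : exists P, is_orthoproj S P.
Proof.
pose M : 'M[K]_(n, \dim S) := \matrix_(i, j) (vbasis S)`_j i 0.
have Mx (x : 'cV_(\dim S)) : M *m x = \sum_j x j 0 *: (vbasis S)`_j.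
  apply/matrixP=> i k; rewrite ord1 mxE summxE.
  by apply: eq_bigr => j _; rewrite !mxE mulrC.
have /and4P[/eqP p1 /eqP p2 /eqP p3 _] := mpinvP M.
exists (M *m mpinv M); apply/and3P; split.
- by rewrite mulmxA p1.
- by rewrite p3.
apply/eqP/vspaceP=> y; apply/colspaceP/idP => [[x ->]|yS].
  rewrite -mulmxA Mx; apply: rpred_sum => j _; apply: rpredZ.
  by apply: vbasis_mem; rewrite mem_nth // size_tuple.
exists y; have -> : y = M *m (\col_j coord (vbasis S) j y).
  by rewrite Mx {1}(coord_vbasis yS); apply: eq_bigr => j _; rewrite mxE.
by rewrite mulmxA p1.
Qed.

Lemma is_orthoproj_uniq n (S : {vspace 'cV[K]_n}) P Q :
  is_orthoproj S P -> is_orthoproj S Q -> P = Q.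
Proof.
have sub P' Q' : is_orthoproj S P' -> is_orthoproj S Q' -> P' *m Q' = Q'.
  move=> /and3P[/eqP p1 _ /eqP p3] /and3P[_ _ /eqP q3].
  apply/matrixP=> i j.
  have /colspaceP[x Ex] : col j Q' \in colspace P'.
    by rewrite p3 -q3; apply/colspaceP; exists (delta_mx j 0); rewrite colE.
  have E : P' *m col j Q' = col j Q' by rewrite Ex mulmxA p1.
  have /matrixP/(_ i 0) := E; rewrite mxE [RHS]mxE => <-.
  by rewrite mxE; apply: eq_bigr => k _; rewrite !mxE.
move=> hP hQ; have /and3P[_ /eqP aP _] := hP; have /and3P[_ /eqP aQ _] := hQ.
by rewrite -aP -(sub _ _ hQ hP) adjmxM aP aQ (sub _ _ hP hQ).
Qed.

Definition orthoproj n (S : {vspace 'cV[K]_n}) : 'M[K]_n :=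
  xchoose (orthoproj_exists S).

Lemma orthoprojP n (S : {vspace 'cV[K]_n}) : is_orthoproj S (orthoproj S).
Proof. exact: xchooseP. Qed.

End Matrices.

Lemma adjmx_realE (R : realType) m n (A : 'M[R]_(m, n)) :
  adjmx (b := RealNumbers) A = A^T.
Proof. by apply/matrixP=> i j; rewrite !mxE. Qed.

Lemma adjmx_complexE (R : realType) m n (A : 'M[R[i]]_(m, n)) :
  adjmx (b := ComplexNumbers) A = map_mx Num.conj A^T.
Proof. by apply/matrixP=> i j; rewrite !mxE. Qed.

(* Main.v *)
Require Import Defs.
From mathcomp Require Import all_boot all_order all_algebra.
From mathcomp Require Import complex reals.

Import Order.TTheory GRing.Theory Num.Theory.
Local Open Scope ring_scope.

(** Put [P = A^+ A] and [Q = B B^+], the orthogonal projections onto the ranges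
    of [A^*] and [B], and [W = A B], [X = B^+ A^+].

    That [X = W^+] gives the cubic identity [X W W^* W X = W^*] is immediate
    from the Penrose equations.  Conversely, multiplying the cubic identity by
    [B] on the left and by [A] on the right turns it into [Q P K Q P = K] with
    [K = B W^* A].  Orthogonal projections do not increase the Frobenius norm,
    and they preserve it only on the matrices which they fix; since the
    norm of [K] survives four projections, none of them can shrink it, which
    forces [P K = K] and [K Q = K] ([sandwich_fixed]).  Cancelling [A] and [B]
    then gives [P B W^* = B W^*], [X W W^* = W^*] and [W^* W X = W^*].  The first
    makes [P] commute with [Q], which yields the two algebraic Penrose
    equations for [X]; the last two say that [X W] and [W X] are Hermitian
    ([reverse_order_of_cubic]).

    For the formula, the pseudoinverse is equivariant under unitary changes of
    basis, so [W^+ = V S^+ U^*].  Since the diagonal of [S] is nonincreasing,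
    its nonzero rows are the first [rank W] ones, whence [D S = S], and this
    passes to [S^+ D = S^+]. *)

Set Implicit Arguments.
Unset Strict Implicit.
Unset Printing Implicit Defensive.

Section PseudoInverse.
Context {R : realType} {b : base_field}.
Local Notation K := (scalar_field R b).

(** * The Frobenius norm and orthogonal projections *)

Definition frob m n (Z : 'M[K]_(m, n)) : K := \tr (adjmx Z *m Z).

Lemma adjmxB m n (Y Z : 'M[K]_(m, n)) : adjmx (Y - Z) = adjmx Y - adjmx Z.
Proof. by rewrite /adjmx map_mxB linearB. Qed.

Lemma frob_ge0 m n (Z : 'M[K]_(m, n)) : 0 <= frob Z.
Proof.
apply: sumr_ge0 => j _; rewrite mxE; apply: sumr_ge0 => i _.
by rewrite !mxE mul_conj_ge0.
Qed.

Lemma frob_eq0 m n (Z : 'M[K]_(m, n)) : frob Z = 0 -> Z = 0.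
Proof.
have col_ge0 j : 0 <= (adjmx Z *m Z) j j.
  by rewrite mxE; apply: sumr_ge0 => i _; rewrite !mxE mul_conj_ge0.
move/eqP; rewrite /frob /mxtrace psumr_eq0 // => /allP Z0.
apply/matrixP=> i j; rewrite mxE; apply/eqP.
have /= := Z0 j (mem_index_enum _); rewrite mxE.
under eq_bigr do rewrite !mxE.
rewrite psumr_eq0 => [/allP/(_ i (mem_index_enum _))|l _].
  by rewrite mul_conj_eq0.
exact: mul_conj_ge0.
Qed.

Lemma frob_adj m n (Z : 'M[K]_(m, n)) :
  frob (adjmx Z) = frob Z.
Proof. by rewrite /frob adjmxK mxtrace_mulC. Qed.

Definition projector n (P : 'M[K]_n) : Prop := P *m P = P /\ adjmx P = P.

(** The cross terms vanish because [P (1 - P) = 0]. *)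
Lemma frob_pythagoras m n (P : 'M[K]_m) (Z : 'M[K]_(m, n)) :
  projector P -> frob Z = frob (P *m Z) + frob (Z - P *m Z).
Proof.
move=> [PP aP]; rewrite /frob -mxtraceD adjmxB adjmxM aP.
congr (\tr _); rewrite mulmxBl !mulmxBr !mulmxA.
by rewrite -(mulmxA _ P P) PP subrr subr0 addrCA subrr addr0.
Qed.

Lemma frob_proj_le m n (P : 'M[K]_m) (Z : 'M[K]_(m, n)) :
  projector P -> frob (P *m Z) <= frob Z.
Proof. by move=> pP; rewrite (frob_pythagoras Z pP) lerDl frob_ge0. Qed.

Lemma frob_proj_fixed m n (P : 'M[K]_m) (Z : 'M[K]_(m, n)) :
  projector P -> frob Z <= frob (P *m Z) -> P *m Z = Z.
Proof.
move=> pP; rewrite (frob_pythagoras Z pP) gerDl => le0.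
apply/esym/eqP; rewrite -subr_eq0; apply/eqP/frob_eq0.
by apply: le_anti; rewrite le0 frob_ge0.
Qed.

Lemma frob_projr_le m n (P : 'M[K]_n) (Z : 'M[K]_(m, n)) :
  projector P -> frob (Z *m P) <= frob Z.
Proof.
by move=> pP; rewrite -frob_adj adjmxM pP.2 -[leRHS]frob_adj frob_proj_le.
Qed.

(** The norm of [Z] passes unchanged through the four projections, so the
    innermost one on the left must fix [Z]. *)
Lemma sandwich_fixedl k (P Q Z : 'M[K]_k) : projector P -> projector Q ->
  Q *m P *m Z *m Q *m P = Z -> P *m Z = Z.
Proof.
move=> pP pQ ZE; apply: frob_proj_fixed => //; rewrite -{1}ZE.
apply: le_trans (frob_projr_le _ pP) _; apply: le_trans (frob_projr_le _ pQ) _.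
by rewrite -mulmxA frob_proj_le.
Qed.

Lemma sandwich_fixed k (P Q Z : 'M[K]_k) : projector P -> projector Q ->
  Q *m P *m Z *m Q *m P = Z -> P *m Z = Z /\ Z *m Q = Z.
Proof.
move=> pP pQ ZE; split; first exact: sandwich_fixedl ZE.
(* Taking adjoints exchanges the roles of P and Q. *)
rewrite -[LHS]adjmxK adjmxM pQ.2 (@sandwich_fixedl _ Q P) ?adjmxK //.
by rewrite -[in RHS]ZE !adjmxM pP.2 pQ.2 !mulmxA.
Qed.

(** * The Moore-Penrose inverse *)

Lemma mpinvK1 m n (A : 'M[K]_(m, n)) : A *m mpinv A *m A = A.
Proof. by case/and4P: (mpinvP A) => /eqP. Qed.

Lemma mpinvK2 m n (A : 'M[K]_(m, n)) : mpinv A *m A *m mpinv A = mpinv A.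
Proof. by case/and4P: (mpinvP A) => _ /eqP. Qed.

Lemma projector_mulmx_mpinv m n (A : 'M[K]_(m, n)) :
  projector (A *m mpinv A).
Proof.
by split; [rewrite mulmxA mpinvK1 | case/and4P: (mpinvP A) => _ _ /eqP].
Qed.

Lemma projector_mpinv_mulmx m n (A : 'M[K]_(m, n)) :
  projector (mpinv A *m A).
Proof.
by split; [rewrite mulmxA mpinvK2 | case/and4P: (mpinvP A) => _ _ _ /eqP].
Qed.

Lemma adjmx_mul_mpinv m n (A : 'M[K]_(m, n)) :
  adjmx A *m (A *m mpinv A) = adjmx A.
Proof. by rewrite -(projector_mulmx_mpinv A).2 -adjmxM mpinvK1. Qed.

Lemma mpinv_mul_adjmx m n (A : 'M[K]_(m, n)) :
  mpinv A *m A *m adjmx A = adjmx A.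
Proof. by rewrite -(projector_mpinv_mulmx A).2 -adjmxM mulmxA mpinvK1. Qed.

Lemma mpinv_unique m n (A : 'M[K]_(m, n)) X : is_mpinv A X -> mpinv A = X.
Proof. exact: is_mpinv_uniq (mpinvP A). Qed.

Lemma cubic_of_mpinv m n (W : 'M[K]_(m, n)) :
  mpinv W *m W *m adjmx W *m W *m mpinv W = adjmx W.
Proof. by rewrite mpinv_mul_adjmx -mulmxA adjmx_mul_mpinv. Qed.

(** Write [G = B B^*].  The hypothesis says that [G] maps the range of [A^*],
    which is the range of [P], into itself.  As [G] is Hermitian it commutes
    with [P], and then so does the projection [Q] onto the range of [G]. *)
Lemma proj_commute m n k (A : 'M[K]_(m, k)) (B : 'M[K]_(k, n)) :
  let P := mpinv A *m A in let Q := B *m mpinv B in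
  P *m (B *m adjmx (A *m B)) = B *m adjmx (A *m B) -> P *m Q = Q *m P.
Proof.
move=> P Q; have [PP aP] : projector P := projector_mpinv_mulmx A.
have [_ aQ] : projector Q := projector_mulmx_mpinv B.
rewrite adjmxM => inv.
pose G := B *m adjmx B.
have aG : adjmx G = G by rewrite /G adjmxM adjmxK.
have GA : P *m (G *m adjmx A) = G *m adjmx A by rewrite /G -(mulmxA B) inv.
have PAs : adjmx A *m adjmx (mpinv A) = P by rewrite -adjmxM aP.
(* Q and G have the same range. *)
have QE : Q = G *m (adjmx (mpinv B) *m mpinv B).
  rewrite /G mulmxA -(mulmxA B) -adjmxM (projector_mpinv_mulmx B).2.
  by rewrite mulmxA mpinvK1.
have QG : Q *m G = G by rewrite /Q /G mulmxA mpinvK1.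
clearbody P Q G.
have PGP : P *m G *m P = G *m P.
  by rewrite -mulmxA -{2 3}PAs (mulmxA G) (mulmxA P) GA.
have PG : P *m G = G *m P.
  have /(congr1 (@adjmx R b _ _)) := PGP.
  by rewrite !adjmxM aP aG mulmxA PGP => <-.
have QPQ : Q *m P *m Q = P *m Q.
  rewrite -mulmxA.
  have -> : P *m Q = G *m (P *m (adjmx (mpinv B) *m mpinv B)).
    by rewrite {1}QE mulmxA PG -mulmxA.
  by rewrite mulmxA QG.
have /(congr1 (@adjmx R b _ _)) := QPQ.
by rewrite !adjmxM aP aQ mulmxA QPQ.
Qed.

Lemma hermitian_of_gram n (M : 'M[K]_n) :
  adjmx M *m M = adjmx M -> adjmx M = M.
Proof. by move=> aMM; rewrite -[RHS]adjmxK -aMM adjmxM adjmxK. Qed.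

Lemma hermitian_of_cogram n (M : 'M[K]_n) :
  M *m adjmx M = adjmx M -> adjmx M = M.
Proof. by move=> MaM; rewrite -[RHS]adjmxK -[in RHS]MaM adjmxM adjmxK MaM. Qed.

(** The last two hypotheses write [(W X)^*] and [(X W)^*] as Gram matrices,
    which makes them Hermitian. *)
Lemma mpinv_of_least_squares m n (W : 'M[K]_(m, n)) (X : 'M[K]_(n, m)) :
  W *m X *m W = W -> X *m W *m X = X ->
  adjmx W *m (W *m X) = adjmx W -> X *m W *m adjmx W = adjmx W ->
  mpinv W = X.
Proof.
move=> p1 p2 l1 l2; apply: mpinv_unique; apply/and4P; split; apply/eqP=> //.
- by apply: hermitian_of_gram; rewrite adjmxM -mulmxA l1.
- by apply: hermitian_of_cogram; rewrite adjmxM mulmxA l2.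
Qed.

Lemma reverse_order_of_cubic m n k (A : 'M[K]_(m, k)) (B : 'M[K]_(k, n)) :
  let W := A *m B in let X := mpinv B *m mpinv A in
  X *m W *m adjmx W *m W *m X = adjmx W -> mpinv W = X.
Proof.
move=> W X cubic.
pose P := mpinv A *m A; pose Q := B *m mpinv B.
have WA : adjmx W *m A *m mpinv A = adjmx W.
  by rewrite -mulmxA /W adjmxM -mulmxA adjmx_mul_mpinv.
have BW : mpinv B *m (B *m adjmx W) = adjmx W.
  by rewrite /W adjmxM !mulmxA mpinv_mul_adjmx.
pose Z := B *m adjmx W *m A.
have ZE : Q *m P *m Z *m Q *m P = Z.
  by rewrite /Z -[in RHS]cubic /Q /P /X {2 4}/W !mulmxA.
have [PZ ZQ] := sandwich_fixed (projector_mpinv_mulmx A) (projector_mulmx_mpinv B) ZE.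
have PB : P *m (B *m adjmx W) = B *m adjmx W.
  by rewrite -WA !(mulmxA B) -/Z mulmxA PZ.
have BQ : adjmx W *m A *m Q = adjmx W *m A.
  have -> : adjmx W *m A = mpinv B *m Z by rewrite /Z -{1}BW !mulmxA.
  by rewrite -(mulmxA _ Z) ZQ.
have PQ : P *m Q = Q *m P by exact: proj_commute.
apply: mpinv_of_least_squares.
- have -> : W *m X *m W = A *m (Q *m P) *m B by rewrite /W /X /P /Q !mulmxA.
  by rewrite -PQ /P /Q !mulmxA mpinvK1 -!mulmxA (mulmxA B) mpinvK1.
- have -> : X *m W *m X = mpinv B *m (P *m Q) *m mpinv A.
    by rewrite /W /X /P /Q !mulmxA.
  by rewrite PQ /P /Q !mulmxA mpinvK2 -!mulmxA (mulmxA (mpinv A)) mpinvK2.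
- by rewrite /X /W !mulmxA -/W -(mulmxA _ B) BQ WA.
- have -> : X *m W *m adjmx W = mpinv B *m (P *m (B *m adjmx W)).
    by rewrite /X /P {1}/W !mulmxA.
  by rewrite PB BW.
Qed.

(** * Pseudoinverse and singular value decomposition *)

Lemma mpinv_unitary m n (U : 'M[K]_m) (S : 'M[K]_(m, n)) (V : 'M[K]_n) :
  unitary U -> unitary V ->
  mpinv (U *m S *m adjmx V) = V *m mpinv S *m adjmx U.
Proof.
move=> /andP[/eqP U1 _] /andP[/eqP V1 _]; apply: mpinv_unique.
set W := U *m S *m adjmx V; set X := V *m mpinv S *m adjmx U.
have WX : W *m X = U *m (S *m mpinv S) *m adjmx U.
  by rewrite /W /X !mulmxA -(mulmxA _ (adjmx V)) V1 mulmx1.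
have XW : X *m W = V *m (mpinv S *m S) *m adjmx V.
  by rewrite /W /X !mulmxA -(mulmxA _ (adjmx U)) U1 mulmx1.
apply/and4P; split; apply/eqP.
- by rewrite WX /W !mulmxA -(mulmxA _ (adjmx U)) U1 mulmx1 -!(mulmxA U) mpinvK1.
- by rewrite XW /X !mulmxA -(mulmxA _ (adjmx V)) V1 mulmx1 -!(mulmxA V) mpinvK2.
- by rewrite WX !adjmxM adjmxK -adjmxM (projector_mulmx_mpinv S).2 mulmxA.
- by rewrite XW !adjmxM adjmxK -adjmxM (projector_mpinv_mulmx S).2 mulmxA.
Qed.

Lemma rank_unitary m n (U : 'M[K]_m) (S : 'M[K]_(m, n)) (V : 'M[K]_n) :
  unitary U -> unitary V -> \rank (U *m S *m adjmx V) = \rank S.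
Proof.
move=> /andP[/eqP U1 _] /andP[/eqP V1 _].
apply/eqP; rewrite eqn_leq; apply/andP; split.
  by apply: leq_trans (mxrankM_maxl _ _) (mxrankM_maxr _ _).
have {1}-> : S = adjmx U *m (U *m S *m adjmx V *m V).
  by rewrite -!mulmxA V1 mulmx1 mulmxA U1 mul1mx.
by apply: leq_trans (mxrankM_maxr _ _) (mxrankM_maxl _ _).
Qed.

(** [S^+ = S^+ (S S^+)], and [D] is absorbed by [S S^+] from the right because
    it is absorbed from the left and both factors are Hermitian. *)
Lemma mpinv_mul_proj m n (D : 'M[K]_m) (S : 'M[K]_(m, n)) :
  adjmx D = D -> D *m S = S -> mpinv S *m D = mpinv S.
Proof.
move=> aD DS; rewrite -{1}(mpinvK2 S) -[RHS]mpinvK2 -!mulmxA; congr (_ *m _).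
by rewrite mulmxA -(projector_mulmx_mpinv S).2 -{1}aD -adjmxM mulmxA DS.
Qed.

Lemma adjmx_pid m r : adjmx (pid_mx r : 'M[K]_m) = pid_mx r.
Proof. by rewrite /adjmx map_pid_mx tr_pid_mx. Qed.

(** The second hypothesis, that zeros of the diagonal propagate downwards, is
    what a nonnegative nonincreasing diagonal provides.  If row [i] is nonzero,
    the first [i + 1] diagonal entries are therefore invertible, and
    dividing by them exhibits [pid_mx i.+1] as a multiple of [S]; so [i] is
    smaller than the rank. *)
Lemma pid_rank_mul_diag m n (S : 'M[K]_(m, n)) :
  (forall i j, val i != val j -> S i j = 0) ->
  (forall i j i' j', val i = val j -> val i' = val j' ->
     (val i <= val i')%N -> S i j = 0 -> S i' j' = 0) ->
  pid_mx (\rank S) *m S = S.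
Proof.
move=> Sdiag Sdown; apply/matrixP=> i j; rewrite mxE.
under eq_bigr do rewrite mxE.
rewrite (bigD1 i) //= big1 => [|l /negPf li]; last first.
  by rewrite eq_sym -val_eqE in li; rewrite li mul0r.
rewrite eqxx addr0 /=.
case: ltnP => [_|lei]; first by rewrite mul1r.
rewrite mul0r; apply/esym/eqP; apply: contraTT lei => Sij0; rewrite -ltnNge.
have ij : val i = val j by apply: contraNeq Sij0 => /Sdiag ->.
pose Z : 'M[K]_(n, m) := \matrix_(p, q)
  (if (val p == val q) && (q < i.+1)%N then (S q p)^-1 else 0).
have ZE : S *m Z = pid_mx i.+1.
  apply/matrixP=> p q; rewrite !mxE.
  have [/andP[/eqP pq pi]|npq] := boolP (_ && _); last first.
    rewrite big1 // => l _; rewrite mxE; case: ifP => [/andP[/eqP lq qi]|_].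
      rewrite (Sdiag p l) ?mul0r //; apply: contraNneq npq => pl.
      by rewrite /= in pl lq; rewrite pl lq eqxx.
    by rewrite mulr0.
  have {pq} -> : q = p by apply/val_inj.
  have pn : (p < n)%N by rewrite (leq_trans pi) // [X in (X < _)%N]ij ltn_ord.
  rewrite (bigD1 (Ordinal pn)) //= big1 => [|l lp].
    rewrite mxE /= eqxx pi addr0.
    by rewrite mulfV //; apply: contra_neq Sij0; apply: Sdown.
  by rewrite Sdiag ?mul0r //; apply: contra_neq lp => pl; apply/val_inj.
rewrite -(rank_pid_mx K (ltn_ord i) (ltn_ord i)) -ZE.
exact: mxrankM_maxl.
Qed.

Lemma of_real_eq0 (x : R) : (of_real b x == 0) = (x == 0).
Proof. by case: b => //=; rewrite eq_complex /= eqxx andbT. Qed.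

Lemma pid_rank_mul_svd m n (W : 'M[K]_(m, n)) U (S : 'M[R]_(m, n)) V :
  is_svd W U S V ->
  pid_mx (\rank W) *m map_mx (@of_real R b) S = map_mx (@of_real R b) S.
Proof.
case=> [[uU uV] Sdiag Spos Sdec ->].
have of_real0 : @of_real R b 0 = 0 by apply/eqP; rewrite of_real_eq0.
rewrite rank_unitary //; apply: pid_rank_mul_diag => [i j ij|i j i' j' ij ij' le].
  by rewrite mxE Sdiag.
rewrite !mxE => /eqP; rewrite of_real_eq0 => /eqP Sij.
suff -> : S i' j' = 0 by [].
by apply: le_anti; rewrite Spos // -Sij Sdec.
Qed.

End PseudoInverse.

Theorem theorem6p3 (R : realType) (b : base_field) (m k n : nat)
    (A : 'M[scalar_field R b]_(m, k)) (B : 'M[scalar_field R b]_(k, n)) :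
  let W := A *m B in
  let X := mpinv B *m mpinv A in
  (mpinv W = X <-> X *m W *m adjmx W *m W *m X = adjmx W) /\
  (mpinv W = X ->
   forall (U : 'M[scalar_field R b]_m) (S : 'M[R]_(m, n)) (V : 'M[scalar_field R b]_n),
     is_svd W U S V ->
     let r := \rank W in
     let D : 'M[scalar_field R b]_m := pid_mx r in
     let Y : 'M[scalar_field R b]_(n, m) := 0 in
     X = V *m mpinv (map_mx (@of_real R b) S) *m D *m adjmx U
         + orthoproj (nullspace W) *m Y *m orthoproj (nullspace (adjmx W))).
Proof.
move=> W X; split.
  split=> [<-|]; [exact: cubic_of_mpinv | exact: reverse_order_of_cubic].
move=> XE U S V svd r D Y; rewrite mulmx0 mul0mx addr0 -XE.
rewrite -(mulmxA V) mpinv_mul_proj ?adjmx_pid ?(pid_rank_mul_svd svd) //.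
by case: svd => [[uU uV] _ _ _ ->]; rewrite mpinv_unitary.
Qed.
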